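(* Let $N$ be a positive integer and let $n_1, n_2, \dots, n_N$ be integers. Consider the rational knot $R(n_1,\dots,n_N)$ given by the special closure of a 4-braid, and let $l_i, m_i, r_i$ be the colors obtained at positions 1, 2, 3 (from left to right) immediately after the $i$-th twist, by propagating downwards the colors $a$, $b$ assigned at the top. Then, for every $1\le i\le N$, $$l_i = a+(b-a)\,p_i^{e},\qquad m_i = a+(b-a)\,p_i,\qquad r_i = a+(b-a)\,p_i^{o}.$$
   Context: **Polynomials.** For $N\ge 1$, $IEO[N]$ is the set of strictly increasing finite sequences $(u_1,\dots,u_k)$ of elements of $\{1,\dots,N\}$ such that $u_j$ is even when $j$ is even and $u_j$ is odd when $j$ is odd, together with the empty sequence $\emptyset$. For $u=(u_1,\dots,u_k)$ put $n_u = n_{u_1}n_{u_2}\cdots n_{u_k}$, and $n_\emptyset = 1$. Set $p_N=\sum_{u\in IEO[N]} n_u$. Let $p_N^{e}$ be the sum of $n_u$ over those $u\in IEO[N]$ of even length (including $\emptyset$), and let $p_N^{o}=p_N-p_N^{e}$. **Rational knots.** $R(n_1,\dots,n_N)$ has the following diagram. Take four vertical strands, with positions numbered 1 to 4 from left to right, read from top to bottom. Join the tops of strands 1 and 2 by a cap and the tops of strands 3 and 4 by a cap. Then perform $N$ successive twists from top to bottom. The $i$-th twist consists of $|n_i|$ crossings, all of the sign of $n_i$, between positions 2 and 3 if $i$ is odd, and between positions 1 and 2 if $i$ is even. At the bottom, positions 1 and 2, and positions 3 and 4, are joined if $N$ is odd; positions 2 and 3, and positions 1 and 4, are joined if $N$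 is even. **Signs of crossings.** Shade the regions of the diagram in checkerboard fashion, leaving the unbounded region unshaded. A crossing is positive if rotating its over-arc counterclockwise about the crossing sweeps out the shaded regions, and negative otherwise. Explicitly: in an odd-indexed twist (positions 2 and 3) a crossing is positive when the strand running from upper left to lower right is the over-strand. In an even-indexed twist (positions 1 and 2) a crossing is positive when the strand running from upper right to lower left is the over-strand. **Propagation of colors.** The top arc joining strands 1 and 2 is given color $b$ and the top arc joining strands 3 and 4 is given color $a$ ($a,b$ integers, or integer indeterminates). So above the first twist positions 1, 2, 3, 4 carry colors $b, b, a, a$. Before imposing the identifications coming from the bottom closure, colors are propagated downwards through the crossings by the Fox rule: the over-strand keeps its color $x$, and an under-strand entering from above with color $y$ emerges below with color $2x-y$. *)

(* Defs.v *)
From mathcomp Require Import all_boot all_order all_algebra.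

Set Implicit Arguments.
Unset Strict Implicit.
Unset Printing Implicit Defensive.

Import GRing.Theory.
Local Open Scope ring_scope.

(* Sequences (u_1, ..., u_k) are lists of nats, u_j being [nth 0 u j.-1]. *)
Definition is_ieo (N : nat) (u : seq nat) : bool :=
  [&& sorted ltn u,
      all (fun x => 1 <= x <= N)%N u
    & all (fun j => odd (nth 0%N u j.-1) == odd j) (iota 1 (size u))].

Lemma size_is_ieo (N : nat) (u : seq nat) : is_ieo N u -> (size u <= N)%N.
Proof.
case/and3P=> su /allP ru _; rewrite -(size_iota 1 N).
apply: uniq_leq_size; first exact: sorted_uniq ltn_trans ltnn _ su.
by move=> x /ru; rewrite mem_iota add1n ltnS.
Qed.

(* By [size_is_ieo], bounding the length by N loses no sequence; the bound
   only serves to make the ambient type finite. *)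
Definition IEO (N : nat) : {set {bseq N of 'I_N.+1}} :=
  [set u : {bseq N of 'I_N.+1} | is_ieo N [seq val x | x <- u]].

Definition monomial (n : nat -> int) (u : seq nat) : int := \prod_(x <- u) n x.

Definition p (n : nat -> int) (N : nat) : int :=
  \sum_(u in IEO N) monomial n [seq val x | x <- u].

Definition p_even (n : nat -> int) (N : nat) : int :=
  \sum_(u in IEO N | ~~ odd (size u)) monomial n [seq val x | x <- u].

Definition p_odd (n : nat -> int) (N : nat) : int := p n N - p_even n N.

Definition pos1 : 'I_4 := @Ordinal 4 0 isT.
Definition pos2 : 'I_4 := @Ordinal 4 1 isT.
Definition pos3 : 'I_4 := @Ordinal 4 2 isT.
Definition pos4 : 'I_4 := @Ordinal 4 3 isT.

(* A crossing between two adjacent positions. [over_falls] tells which strand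
   is the over-strand: the one running from upper left to lower right if it is
   true, the one running from upper right to lower left otherwise. *)
Record crossing := Crossing { slot : 'I_3; over_falls : bool }.

Definition left_pos (c : crossing) : 'I_4 := lift ord_max (slot c).
Definition right_pos (c : crossing) : 'I_4 := lift ord0 (slot c).

Definition slot12 : 'I_3 := @Ordinal 3 0 isT.
Definition slot23 : 'I_3 := @Ordinal 3 1 isT.

(* The crossing of sign + (resp. -) in the i-th twist, for [positive] equal to
   true (resp. false), under the checkerboard sign convention. *)
Definition twist_crossing (i : nat) (positive : bool) : crossing :=
  if odd i then Crossing slot23 positive else Crossing slot12 (~~ positive).

Definition twist (i : nat) (m : int) : seq crossing :=
  nseq `|m|%N (twist_crossing i (0 < m)).

(* A 4-braid, cut into successive twists from top to bottom, together with the
   arcs closing it at the top and at the bottom. *)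
Record diagram := Diagram {
  top_arcs : seq ('I_4 * 'I_4);
  twists : seq (seq crossing);
  bottom_arcs : seq ('I_4 * 'I_4)
}.

(* Only the values n 1, ..., n N are used. *)
Definition rational_diagram (N : nat) (n : nat -> int) : diagram :=
  Diagram [:: (pos1, pos2); (pos3, pos4)]
          [seq twist i (n i) | i <- iota 1 N]
          (if odd N then [:: (pos1, pos2); (pos3, pos4)]
           else [:: (pos2, pos3); (pos1, pos4)]).

Definition fox (R : comNzRingType) (over under : R) : R := 2 * over - under.

Definition propagate (R : comNzRingType) (col : 'I_4 -> R) (c : crossing) :
    'I_4 -> R :=
  let x := col (left_pos c) in
  let y := col (right_pos c) in
  fun k =>
    if k == left_pos c then (if over_falls c then fox x y else y)
    else if k == right_pos c then (if over_falls c then x else fox y x)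
    else col k.

(* [s] lists the colors of the arcs in [top_arcs D], in the same order. *)
Definition top_colors (R : comNzRingType) (D : diagram) (s : seq R) :
    'I_4 -> R :=
  fun k => s`_(find (fun e => (k == e.1) || (k == e.2)) (top_arcs D)).

(* The bottom arcs impose no condition here. *)
Definition colors_after (R : comNzRingType) (D : diagram) (s : seq R)
    (i : nat) : 'I_4 -> R :=
  foldl (@propagate R) (top_colors D s) (flatten (take i (twists D))).

(* Main.v *)
Require Import Defs.
From mathcomp Require Import all_boot all_order all_algebra.
From mathcomp Require Import ring.

(** Two linear recurrences coincide.

    On the colour side, one crossing on two adjacent strands coloured [x, y]
    adds the same amount, [x - y] or [y - x] according to which strand is over,
    to both colours: the difference is left invariant, so a whole twist adds a
    fixed multiple of it ([propagate_nseq]).  With the checkerboard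
    convention for signs, the [i]-th twist adds [n i] times the difference
    [m - r] (for [i] odd) or [m - l] (for [i] even) to the two colours involved
    ([propagate_twist]).

    On the polynomial side, an increasing sequence in [IEO (N.+1)] either lies
    in [IEO N] or ends with [N.+1]; in the latter case the parity condition on
    its last entry says precisely that its length has the parity of [N.+1].
    Hence only one of the two parity parts of [p] changes, by [n N.+1] times the
    other part ([p_parityS]).

    Under [l = a + (b - a) p^e], [m = a + (b - a) (p^e + p^o)] and
    [r = a + (b - a) p^o] the differences [m - r] and [m - l] are [(b - a) p^e]
    and [(b - a) p^o], so both recurrences agree; they start from the same
    values because the only sequence in [IEO 0] is the empty one. *)

Set Implicit Arguments.
Unset Strict Implicit.
Unset Printing Implicit Defensive.

Import GRing.Theory.
Local Open Scope ring_scope.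

(** * Recurrence for the polynomials *)

(** An admissible sequence is built entry by entry: appending [x] only asks that
    the previous entries be smaller than [x] and that [x] have the parity of its
    own position. *)
Lemma is_ieo_rcons (N : nat) (u : seq nat) (x : nat) :
  is_ieo N (rcons u x) =
    [&& is_ieo x.-1 u, (1 <= x <= N)%N & odd x != odd (size u)].
Proof.
rewrite /is_ieo !(sorted_pairwise ltn_trans) pairwise_rcons.
rewrite all_rcons size_rcons -[(size u).+1]addn1 iotaD all_cat /=.
rewrite nth_rcons ltnn eqxx andbT /=.
have -> : all (fun j => odd (nth 0%N (rcons u x) j.-1) == odd j)
              (iota 1 (size u)) =
          all (fun j => odd (nth 0%N u j.-1) == odd j) (iota 1 (size u)).
  apply: eq_in_all => j; rewrite mem_iota add1n ltnS => /andP[j1 ju].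
  by rewrite nth_rcons prednK // ju.
have -> : (odd x != odd (size u)) = (odd x == ~~ odd (size u)).
  by case: (odd x); case: (odd (size u)).
have [/andP[x1 xN]|] := boolP (1 <= x <= N)%N; last by rewrite /= !andbF.
(* The upper bound N on the entries of u is implied by their being below x. *)
have -> : all (fun y => 1 <= y <= x.-1)%N u =
          all (ltn^~ x) u && all (fun y => 1 <= y <= N)%N u.
  rewrite -all_predI; apply: eq_all => y /=.
  rewrite -[(y <= x.-1)%N]ltnS prednK //; case: (ltnP y x) => yx; last by rewrite andbF.
  by rewrite (leq_trans (ltnW yx) xN).
by rewrite add0n -!andbA; do !bool_congr.
Qed.

Fixpoint ieo_seq (N : nat) : seq (seq nat) :=
  if N is M.+1 then
    ieo_seq M ++ [seq rcons u N | u <- ieo_seq M & odd (size u) == odd M]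
  else [:: [::]].

Lemma mem_ieo_seq (N : nat) (u : seq nat) : (u \in ieo_seq N) = is_ieo N u.
Proof.
elim: N u => [|N IHN] u.
  case/lastP: u => [|u x] //; rewrite is_ieo_rcons.
  by rewrite inE -size_eq0 size_rcons; case: x => [|x]; rewrite !andbF.
rewrite mem_cat IHN; case/lastP: u => [|u x] //.
rewrite !is_ieo_rcons.
have -> : (rcons u x \in
    [seq rcons v N.+1 | v <- ieo_seq N & odd (size v) == odd N]) =
    [&& x == N.+1, is_ieo N u & odd (size u) == odd N].
  apply/mapP/and3P => [[v]|[/eqP-> hu hs]].
    rewrite mem_filter IHN => /andP[hs hv] /rcons_inj[-> ->].
    by split.
  by exists u => //; rewrite mem_filter IHN hs.
rewrite [(x <= N.+1)%N]leq_eqVlt ltnS; case: (eqVneq x N.+1) => [->|_] /=.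
  rewrite ltnn /= andbF /=.
  by case: (odd N); case: (odd (size u)).
by rewrite orbF.
Qed.

Lemma ieo_seq_uniq (N : nat) : uniq (ieo_seq N).
Proof.
elim: N => //= N IHN; rewrite cat_uniq IHN /=.
rewrite map_inj_uniq ?filter_uniq // ?andbT; last by move=> u v /rcons_inj[].
apply/hasPn => _ /mapP[u _ ->]; rewrite /= mem_ieo_seq is_ieo_rcons.
by rewrite ltnn !andbF.
Qed.

(** The ambient finite type of [IEO N] varies with [N]; the lists [ieo_seq N]
    all live in [seq nat] and are therefore comparable for different [N]. *)
Lemma sum_IEO (V : nmodType) (N : nat) (P : pred nat) (F : seq nat -> V) :
  \sum_(u in IEO N | P (size u)) F [seq val x | x <- u] =
    \sum_(u <- ieo_seq N | P (size u)) F u.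
Proof.
pose f (u : {bseq N of 'I_N.+1}) := [seq val x | x <- u].
have f_inj : injective f by move=> u v /(inj_map val_inj)/val_inj.
rewrite [RHS](perm_big [seq f u | u <- enum (IEO N)]) /=; last first.
  apply: uniq_perm; first exact: ieo_seq_uniq.
    by rewrite map_inj_uniq ?enum_uniq.
  move=> u; rewrite mem_ieo_seq; apply/idP/mapP => [hu|[v]]; last first.
    by rewrite mem_enum inE => hv ->.
  have hs : (size [seq inord x : 'I_N.+1 | x <- u] <= N)%N.
    by rewrite size_map size_is_ieo.
  have fE : f (Bseq hs) = u.
    rewrite /f /= -map_comp -[RHS]map_id; apply/eq_in_map => x xu /=.
    case/and3P: hu => _ /allP/(_ x xu)/andP[_ xN] _.
    by rewrite inordK // ltnS.
  by exists (Bseq hs); rewrite // mem_enum inE -/(f _) fE.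
rewrite big_map -big_enum_cond /=.
by apply: eq_big => // u; rewrite size_map.
Qed.

Definition p_parity (c : bool) (n : nat -> int) (N : nat) : int :=
  \sum_(u <- ieo_seq N | odd (size u) == c) monomial n u.

Lemma p_evenE (n : nat -> int) (N : nat) : p_even n N = p_parity false n N.
Proof.
rewrite /p_even (sum_IEO _ (fun k => ~~ odd k)).
by apply: eq_bigl => u; case: (odd _).
Qed.

Lemma p_split (n : nat -> int) (N : nat) :
  p n N = p_parity false n N + p_parity true n N.
Proof.
have -> : p n N = \sum_(u <- ieo_seq N) monomial n u.
  rewrite -(sum_IEO N predT).
  by apply: eq_bigl => u; rewrite andbT.
rewrite (bigID (fun u => odd (size u) == false)) /=.
by congr (_ + _); apply: eq_bigl => u; case: (odd _).
Qed.

Lemma p_oddE (n : nat -> int) (N : nat) : p_odd n N = p_parity true n N.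
Proof. by rewrite /p_odd p_split p_evenE addrC addKr. Qed.

Lemma p_parity0 (c : bool) (n : nat -> int) : p_parity c n 0 = (~~ c)%:R.
Proof. by rewrite /p_parity big_mkcond big_seq1 /monomial big_nil; case: c. Qed.

(** Sequences ending with [N.+1] have length of the parity of [N.+1]; dropping
    that entry leaves a sequence in [IEO N] whose length has the opposite
    parity. *)
Lemma p_parityS (c : bool) (n : nat -> int) (N : nat) :
  p_parity c n N.+1 =
    p_parity c n N + (if odd N.+1 == c then n N.+1 * p_parity (~~ c) n N else 0).
Proof.
rewrite /p_parity /= big_cat /=; congr (_ + _).
rewrite big_map big_filter_cond /=; case: eqP => [<-|/eqP hc].
  rewrite negbK big_distrr /=; apply: eq_big => [u|u _].
    by rewrite size_rcons /=; case: (odd (size u)); case: (odd N).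
  by rewrite /monomial big_rcons mulrC.
rewrite big_pred0 // => u; rewrite size_rcons /=.
by move: hc; case: (odd (size u)); case: (odd N); case: c.
Qed.

(** * Recurrence for the colours *)

Section Propagation.
Variable R : comNzRingType.
Implicit Types (col : 'I_4 -> R) (c : crossing).

Definition increment col c : R :=
  if over_falls c then col (left_pos c) - col (right_pos c)
  else col (right_pos c) - col (left_pos c).

Lemma propagateE col c k :
  propagate col c k =
    col k + (if k \in [:: left_pos c; right_pos c] then increment col c else 0).
Proof.
rewrite /propagate /increment /fox !inE.
have [->|_] := eqVneq k (left_pos c); first by case: over_falls => /=; ring.
have [->|_] := eqVneq k (right_pos c); first by case: over_falls => /=; ring.
by rewrite addr0.
Qed.

(** Both strands of a crossing are shifted by the same amount, so that the next
    crossing of the twist sees the same difference of colours. *)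
Lemma propagate_nseq col c h k :
  foldl (@propagate R) col (nseq h c) k =
    col k + (if k \in [:: left_pos c; right_pos c] then increment col c *+ h
             else 0).
Proof.
elim: h col => [|h IHh] col /=; first by rewrite mulr0n if_same addr0.
have inc_inv : increment (propagate col c) c = increment col c.
  rewrite {1}/increment !propagateE !inE !eqxx orbT /=.
  by rewrite /increment; case: over_falls; ring.
rewrite IHh inc_inv propagateE -addrA; congr (_ + _).
by case: ifP; rewrite ?addr0 // mulrS.
Qed.

(** The checkerboard convention mirrors the two slots, which makes the middle
    colour the one from which the other is subtracted in both cases. *)
Lemma propagate_twist col i (m : int) k :
  foldl (@propagate R) col (twist i m) k =
    col k + (if k \in (if odd i then [:: pos2; pos3] else [:: pos1; pos2])
             then (col pos2 - col (if odd i then pos3 else pos1)) * m%:~R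
             else 0).
Proof.
have l12 : lift ord_max slot12 = pos1 by apply: val_inj.
have r12 : lift ord0 slot12 = pos2 by apply: val_inj.
have l23 : lift ord_max slot23 = pos2 by apply: val_inj.
have r23 : lift ord0 slot23 = pos3 by apply: val_inj.
rewrite /twist propagate_nseq /increment /left_pos /right_pos /twist_crossing.
congr (_ + _).
case: (odd i) => /=; rewrite ?l12 ?r12 ?l23 ?r23; congr (if _ then _ else _);
  case: m => [[|h]|h] /=; rewrite ?NegzE ?mulrNz ?mulr0n ?mulr0 //.
- by rewrite -[_ *+ _]mulr_natr.
- by rewrite mulrN -mulNr opprB -[LHS]mulr_natr.
- by rewrite -[_ *+ _]mulr_natr.
- by rewrite mulrN -mulNr opprB -[LHS]mulr_natr.
Qed.

Lemma colors_afterS (N i : nat) (n : nat -> int) (s : seq R) : (i < N)%N ->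
  colors_after (rational_diagram N n) s i.+1 =
    foldl (@propagate R) (colors_after (rational_diagram N n) s i)
          (twist i.+1 (n i.+1)).
Proof.
move=> iN; rewrite /colors_after (take_nth [::]) ?size_map ?size_iota //=.
by rewrite flatten_rcons foldl_cat (nth_map 0%N) ?size_iota // nth_iota.
Qed.

End Propagation.

(** The statement for [i = 0], the colours above the first twist, makes the
    induction start without computing any twist. *)
Lemma colors_after_parity (R : comNzRingType) (N : nat) (n : nat -> int)
    (a b : R) (i : nat) : (i <= N)%N ->
  let col := colors_after (rational_diagram N n) [:: b; a] i in
  [/\ col pos1 = a + (b - a) * (p_parity false n i)%:~R,
      col pos2 =
        a + (b - a) * (p_parity false n i + p_parity true n i)%:~R
    & col pos3 = a + (b - a) * (p_parity true n i)%:~R].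
Proof.
elim: i => [_|i IHi iN] /=.
  rewrite /colors_after take0 /top_colors /= !p_parity0 /=.
  by split; rewrite ?addr0 ?mulr1 ?mulr0 ?addr0 // addrC subrK.
have [h1 h2 h3] := IHi (ltnW iN).
rewrite colors_afterS // !propagate_twist !p_parityS /=.
case: (odd i) => /=; rewrite h1 h2 h3 !(rmorphD, rmorphM) /=;
  split; rewrite ?rmorph0; ring.
Qed.

Theorem proposition6p1 (R : comNzRingType) (N : nat) (n : nat -> int)
    (a b : R) (hN : (1 <= N)%N) (i : nat) (hi : (1 <= i <= N)%N) :
  let col := colors_after (rational_diagram N n) [:: b; a] i in
  [/\ col pos1 = a + (b - a) * (p_even n i)%:~R,
      col pos2 = a + (b - a) * (p n i)%:~R
    & col pos3 = a + (b - a) * (p_odd n i)%:~R].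
Proof.
rewrite p_evenE p_oddE p_split; case/andP: hi => _.
exact: colors_after_parity.
Qed.
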